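(* Let $\mathbb{F}_2^{n-1}$ be identified with a hyperplane (an $(n-1)$-dimensional linear subspace) of $\mathbb{F}_2^n$, let $e_0\in\mathbb{F}_2^n\setminus\mathbb{F}_2^{n-1}$, and let $f,g\colon\mathbb{F}_2^{n-1}\to\mathbb{F}_2^m$ be functions. Define $F\colon\mathbb{F}_2^n\to\mathbb{F}_2^m$ by $F(x):=f(x)$ and $F(x+e_0):=g(x)$ for $x\in\mathbb{F}_2^{n-1}$. Then $F$ is APN if and only if both of the following hold: (1) $f$ and $g$ are APN functions from $\mathbb{F}_2^{n-1}$ to $\mathbb{F}_2^m$; (2) $f(x+a)+f(x)+g(y+a)+g(y)\neq 0$ for all $x,y\in\mathbb{F}_2^{n-1}$ and all nonzero $a\in\mathbb{F}_2^{n-1}$.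
   Context: A function $F\colon\mathbb{F}_2^k\to\mathbb{F}_2^m$ is APN if for every nonzero $a\in\mathbb{F}_2^k$ and every $b\in\mathbb{F}_2^m$ the set $\{x\in\mathbb{F}_2^k: F(x+a)+F(x)=b\}$ has at most $2$ elements. Note $\mathbb{F}_2^n=\mathbb{F}_2^{n-1}\cup(\mathbb{F}_2^{n-1}+e_0)$, so $F$ is well defined on all of $\mathbb{F}_2^n$. *)

(* Defs.v *)
From HB Require Import structures.
From mathcomp Require Import all_boot all_order all_algebra.

Set Implicit Arguments.
Unset Strict Implicit.
Unset Printing Implicit Defensive.

Import GRing.Theory.
Local Open Scope ring_scope.

Definition APN (k m : nat) (F : 'rV['F_2]_k -> 'rV['F_2]_m) : Prop :=
  forall (a : 'rV['F_2]_k) (b : 'rV['F_2]_m),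
    a != 0 -> (#|[set x | (F (x + a) + F x == b)%R]| <= 2)%N.

(* Well-definedness: the two equations F (iota x) = f x and
   F (iota x + e0) = g x, where iota identifies F_2^(n-1) with a hyperplane
   missing e0, are satisfied by one and only one function F on F_2^n. *)
Lemma glue_exists (n m : nat) (iota : 'Hom('rV['F_2]_n.-1, 'rV['F_2]_n))
    (iota_inj : injective iota) (e0 : 'rV['F_2]_n) (he0 : e0 \notin limg iota)
    (f g : 'rV['F_2]_n.-1 -> 'rV['F_2]_m) :
  exists F : 'rV['F_2]_n -> 'rV['F_2]_m,
    (forall x, F (iota x) = f x) /\ (forall x, F (iota x + e0) = g x).
Proof.
exists (fun z => if [pick x | iota x == z] is Some x then f x else
                 if [pick x | iota x + e0 == z] is Some x then g x else 0).
split=> x.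
  by case: pickP => [y /eqP/iota_inj-> // | /(_ x)]; rewrite eqxx.
case: pickP => [y /eqP eq_y | _].
  case/negP: he0; have ->: e0 = iota (y - x).
    by rewrite linearB /= eq_y addrAC subrr add0r.
  by rewrite memv_img ?memvf.
by case: pickP => [y /eqP/addIr/iota_inj-> // | /(_ x)]; rewrite eqxx.
Qed.

Lemma glue_unique (n m : nat) (n_gt0 : (0 < n)%N)
    (iota : 'Hom('rV['F_2]_n.-1, 'rV['F_2]_n))
    (iota_inj : injective iota) (e0 : 'rV['F_2]_n) (he0 : e0 \notin limg iota)
    (F G : 'rV['F_2]_n -> 'rV['F_2]_m) :
    (forall x, F (iota x) = G (iota x)) ->
    (forall x, F (iota x + e0) = G (iota x + e0)) ->
  F =1 G.
Proof.
move=> eqH eqHe z.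
have dimi : \dim (limg iota) = n.-1.
  rewrite limg_dim_eq ?dimvf /dim /= ?mul1n //.
  by apply/eqP; rewrite capfv; apply/lker0P.
have e0n0 : e0 != 0 by apply: contraNneq he0 => ->; rewrite mem0v.
have full : (limg iota + <[e0]>)%VS = fullv.
  apply/eqP; rewrite eqEdim subvf dimvf /dim /= mul1n.
  have dxe : (limg iota :&: <[e0]> = 0)%VS.
    apply/eqP; rewrite -subv0; apply/subvP=> v.
    rewrite memv_cap memv0 => /andP[vi /vlineP[c vE]].
    have [c0 | cn0] := eqVneq c 0; first by rewrite vE c0 scale0r.
    case/negP: he0; have ->: e0 = c^-1 *: v by rewrite vE scalerA mulVf ?scale1r.
    by rewrite memvZ.
  by rewrite dimv_disjoint_sum // dimi dim_vline e0n0 addn1 prednK.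
have /memv_addP[u /memv_imgP[x _ ->] [v /vlineP[c ->] ->]] :
  z \in (limg iota + <[e0]>)%VS by rewrite full memvf.
have [-> | ->] : c = 0 \/ c = 1.
- by case: c => -[|[|//]] i; [left | right]; apply: val_inj.
- by rewrite scale0r addr0.
- by rewrite scale1r.
Qed.

(* Main.v *)
(** Over [F_2], [F] is APN iff [F (u + a) + F u = F (v + a) + F v] with [a != 0]
forces [v] to be [u] or [u + a].  For [a] in the hyperplane, this says that [f]
and [g] are APN when [u] and [v] lie in the same coset, and it is condition (2)
when they lie in different cosets.  For [a = a' + e0], replacing [u] by [u + a]
and [v] by [v + a] if needed, one may take [u = x] and [v = y] in the
hyperplane; the equation [g (x + a') + f x = g (y + a') + f y] then violates
condition (2) in the direction [x + y] unless [x = y]. *)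
Require Import Defs.
From HB Require Import structures.
From mathcomp Require Import all_boot all_order all_algebra.
Import GRing.Theory.
Local Open Scope ring_scope.

Lemma oppF2v k (v : 'rV['F_2]_k) : - v = v.
Proof. by apply/rowP=> i; rewrite mxE (oppr_pchar2 (pchar_Fp _)). Qed.

Lemma addF2vK k (u v : 'rV['F_2]_k) : u + v + v = u.
Proof. by rewrite -{2}[v]oppF2v addrK. Qed.

Lemma addF2v_eq0 k (u v : 'rV['F_2]_k) : (u + v == 0) = (u == v).
Proof. by rewrite addr_eq0 oppF2v. Qed.

(** Since [a + a = 0], translation by [a] preserves each solution set of [F (x + a) + F x = b]. A
    solution [u] thus brings along [u + a], and the bound 2 excludes any third one. *)
Lemma APN_fiberP k m (F : 'rV['F_2]_k -> 'rV['F_2]_m) :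
  APN F <-> (forall a u v : 'rV['F_2]_k, a != 0 ->
               F (u + a) + F u = F (v + a) + F v -> v = u \/ v = u + a).
Proof.
split=> [apnF a u v a0 eq_uv | fibF a b a0].
  have [->|neq_vu] := eqVneq v u; first by left.
  have [->|neq_vua] := eqVneq v (u + a); first by right.
  have neq_ua : u != u + a by rewrite eq_sym -subr_eq0 addrAC subrr add0r.
  have := apnF a (F (u + a) + F u) a0; rewrite leqNgt => /negP[].
  have <- : #|v |: [set u; u + a]| = 3%N.
    by rewrite cardsU1 cards2 !inE negb_or neq_vu neq_vua neq_ua.
  apply/subset_leq_card/subsetP => z; rewrite !inE.
  case/or3P=> /eqP->; rewrite ?eq_uv ?eqxx //.
  by rewrite addF2vK addrC -eq_uv.
set S := [set x | _]; have [->|[u]] := set_0Vmem S; first by rewrite cards0.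
rewrite inE => /eqP Fu; apply: (@leq_trans #|[set u; u + a]|).
  apply/subset_leq_card/subsetP => v; rewrite !inE => /eqP Fv.
  have [|->|->] := fibF a u v a0; rewrite ?Fu ?Fv ?eqxx ?orbT //.
by rewrite cards2 ltnS leq_b1.
Qed.

(* An application of [glue_unique]: the indicator of the union of the two cosets
agrees with the constant [1] on both of them. *)
Lemma coset_decomposition n (n_gt0 : (0 < n)%N)
    (iota : 'Hom('rV['F_2]_n.-1, 'rV['F_2]_n)) (iota_inj : injective iota)
    (e0 : 'rV['F_2]_n) (he0 : e0 \notin limg iota) z :
  exists x, z = iota x \/ z = iota x + e0.
Proof.
pose P z := [exists x, (z == iota x) || (z == iota x + e0)].
pose G z : 'rV['F_2]_1 := const_mx (P z)%:R.
have /(_ z)/rowP/(_ 0) : G =1 (fun=> const_mx 1).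
  apply: (@glue_unique n 1 n_gt0 iota iota_inj e0 he0) => x; rewrite /G.
    by have -> : P (iota x) by apply/existsP; exists x; rewrite eqxx.
  by have -> : P (iota x + e0) by apply/existsP; exists x; rewrite eqxx orbT.
rewrite !mxE; case: (boolP (P z)) => [/existsP[x /orP[] /eqP-> _] | _ /eqP].
- by exists x; left.
- by exists x; right.
- by rewrite eq_sym oner_eq0.
Qed.

Theorem theorem1 (n m : nat) (n_gt0 : (0 < n)%N)
    (H : {vspace 'rV['F_2]_n}) (dimH : \dim H = n.-1)
    (iota : 'Hom('rV['F_2]_n.-1, 'rV['F_2]_n))
    (iota_inj : injective iota) (iota_img : limg iota = H)
    (e0 : 'rV['F_2]_n) (he0 : e0 \notin H)
    (f g : 'rV['F_2]_n.-1 -> 'rV['F_2]_m)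
    (F : 'rV['F_2]_n -> 'rV['F_2]_m)
    (Ff : forall x : 'rV['F_2]_n.-1, F (iota x) = f x)
    (Fg : forall x : 'rV['F_2]_n.-1, F (iota x + e0) = g x) :
  APN F <->
  (APN f /\ APN g) /\
  (forall x y a : 'rV['F_2]_n.-1, a != 0 ->
     f (x + a) + f x + g (y + a) + g y != 0).
Proof.
have he0i : e0 \notin limg iota by rewrite iota_img.
have iota0 a : (iota a == 0) = (a == 0) by rewrite -(inj_eq iota_inj) linear0.
have off x y : iota y + e0 <> iota x.
  move=> eq_xy; case/negP: he0i; have -> : e0 = iota (x - y).
    by rewrite linearB /= -eq_xy addrAC subrr add0r.
  by rewrite memv_img ?memvf.
have Ffa x a : F (iota x + iota a) = f (x + a) by rewrite -linearD Ff.
have Fga x a : F (iota x + e0 + iota a) = g (x + a).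
  by rewrite addrAC -linearD Fg.
split=> [/APN_fiberP fibF | [[/APN_fiberP fibf /APN_fiberP fibg] fg]].
  split; [split; apply/APN_fiberP|]
    => [a x y a0 eq_xy | a x y a0 eq_xy | x y a a0].
  - have [||/iota_inj|] := fibF (iota a) (iota x) (iota y).
    + by rewrite iota0.
    + by rewrite !Ffa !Ff.
    + by left.
    + by rewrite -linearD => /iota_inj; right.
  - have [||/addIr/iota_inj|] :=
      fibF (iota a) (iota x + e0) (iota y + e0).
    + by rewrite iota0.
    + by rewrite !Fga !Fg.
    + by left.
    + by rewrite addrAC -linearD => /addIr/iota_inj; right.
  (* A zero sum would make [iota x] and [iota y + e0] solutions for the same right-hand side, but
     [iota x] and [iota x + iota a] both lie in the hyperplane. *)
  - rewrite -addrA addF2v_eq0; apply/eqP => eq_xy.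
    have [|||] := fibF (iota a) (iota x) (iota y + e0).
    + by rewrite iota0.
    + by rewrite Ffa Fga Ff Fg.
    + exact: off.
    + by rewrite -linearD; apply: off.
apply/APN_fiberP=> a u v.
have fg' x y b : b != 0 -> f (x + b) + f x <> g (y + b) + g y.
  by move=> b0 /eqP; rewrite -addF2v_eq0 addrA; apply/negP/fg.
have dec := coset_decomposition _ n_gt0 _ iota_inj _ he0i.
have [b [] ->] := dec a.
  rewrite iota0 => b0.
  have [x [] ->] := dec u; have [y [] ->] := dec v.
  - rewrite !Ffa !Ff => /(fibf _ _ _ b0)[]->; first by left.
    by right; rewrite linearD.
  - by rewrite Ffa Fga Ff Fg => /(fg' _ _ _ b0).
  - by rewrite Ffa Fga Ff Fg => /esym/(fg' _ _ _ b0).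
  - rewrite !Fga !Fg => /(fibg _ _ _ b0)[]->; first by left.
    by right; rewrite linearD addrAC.
move=> _; set c := iota b + e0.
have cross x y : F (iota x + c) + F (iota x) = F (iota y + c) + F (iota y) ->
    x = y.
  rewrite /c !addrA -!linearD !Fg !Ff => eq_xy.
  apply/eqP; rewrite -addF2v_eq0; apply/negPn/negP => xy0.
  (* Shifting by [x + y] sends [x] to [y] and [x + b] to [y + b], so the four values in (2) are
     those of [eq_xy]. *)
  apply: (fg' x (x + b) _ xy0).
  have xxy : x + (x + y) = y by rewrite addrC [x + y]addrC addF2vK.
  rewrite addrAC xxy; apply: (addIr (g (x + b))).
  by rewrite addF2vK -addrA [f x + _]addrC eq_xy [f y + _]addrC addF2vK.
(* The vector [c] represents the same coset as [e0]. With [c] as representative, adding the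
   direction [c] merely swaps [iota x] and [iota x + c], so all four cases below reduce to
   [cross]. *)
have normal w : exists x, w = iota x \/ w = iota x + c.
  have [x [] ->] := dec w; first by exists x; left.
  by exists (x + b); right; rewrite /c linearD addrA addF2vK.
have [x [] ->] := normal u; have [y [] ->] := normal v; rewrite ?addF2vK.
- by move=> /cross->; left.
- by rewrite [RHS]addrC => /cross->; right.
- by rewrite addrC => /cross->; right.
- by rewrite addrC [RHS]addrC => /cross->; left.
Qed.
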